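(* Let $G$ be a group of order $n$, written additively, and let $\mathcal{S}'=\{D_1,\ldots,D_r\}$ be a family of pairwise disjoint $k$-subsets of $G$ such that each $D_i$ is an $(n,k,\lambda,\mu)$-partial difference set. Let $S=\bigcup_{i=1}^r D_i$. If any of the following holds: (i) $G\setminus S$ is a difference set; (ii) $G\setminus S$ is a proper partial difference set; (iii) $G^*\setminus S$ is a proper partial difference set; then $\mathcal{S}'$ is a disjoint partial difference family which is also an external partial difference family.
   Context: $G^*=G\setminus\{0\}$. For $D\subseteq G$, $\Delta(D)$ is the multiset $\{x-y: x,y\in D,\ x\neq y\}$; for disjoint $D_1,D_2$, $\Delta(D_1,D_2)$ is the multiset $\{x-y:x\in D_1,y\in D_2\}$; $\lambda A$ is the multiset with $\lambda$ copies of each element of $A$. A subset $D$ is a difference set if $\Delta(D)=\lambda G^*$ for some $\lambda$, and an $(n,|D|,\lambda,\mu)$-partial difference set if $\Delta(D)=\lambda D+\mu(G^*\setminus D)$; the latter is proper if $\lambda\neq\mu$. A collection $\{D_1,\dots,D_r\}$ of disjoint $k$-subsets with $S=\bigcup_i D_i$ is a disjoint partial difference family if $\bigcup_{i}\Delta(D_i)=\lambda' S+\mu'(G^*\setminus S)$ for some integers $\lambda',\mu'$, and an external partial difference family if $\bigcup_{i\neq j}\Delta(D_i,D_j)=\lambda'' S+\mu''(G^*\setminus S)$ for some integers $\lambda'',\mu''$.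
   Formalization: In the defining equations of partial difference sets and of disjoint/external partial difference families, λD and λS count only the nonzero elements of D or S; read literally with 0 in S the claim fails (Z_3, D_1={0}, D_2={1}). *)

(* Defs.v *)
From mathcomp Require Import all_boot fingroup.
From mathcomp Require Import finmap multiset.

Set Implicit Arguments.
Unset Strict Implicit.
Unset Printing Implicit Defensive.

Local Open Scope mset_scope.
Local Open Scope group_scope.

(* The group need not be abelian and is written multiplicatively here: x - y  *)
(* is rendered x * y^-1, the identity is 1, and G^* is [set: gT]^#.           *)

Section PartialDifferenceSets.

Variable gT : finGroupType.
Implicit Types (A D : {set gT}) (n k lambda mu : nat).

Definition copies lambda A : {mset gT} :=
  \big[msetD/mset0]_(x in A) msetn lambda x.

Definition Delta D : {mset gT} :=
  \big[msetD/mset0]_(x in D) \big[msetD/mset0]_(y in D | x != y)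
    [mset x * y^-1].

Definition Delta2 (D1 D2 : {set gT}) : {mset gT} :=
  \big[msetD/mset0]_(x in D1) \big[msetD/mset0]_(y in D2) [mset x * y^-1].

(* lambda A + mu (G^* \ A), as a multiset on G^*: since differences of        *)
(* distinct elements are never 1, only the nonidentity elements of A count.   *)
Definition two_valued lambda mu A : {mset gT} :=
  copies lambda A^# `+` copies mu ([set: gT]^# :\: A).

Definition difference_set D : Prop :=
  exists lambda, Delta D = copies lambda [set: gT]^#.

Definition partial_difference_set n k lambda mu D : Prop :=
  [/\ #|gT| = n, #|D| = k & Delta D = two_valued lambda mu D].

Definition proper_partial_difference_set D : Prop :=
  exists lambda mu,
    lambda <> mu /\ partial_difference_set #|gT| #|D| lambda mu D.

Section Families.

Variables (r : nat).
Implicit Types F : 'I_r -> {set gT}.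

Definition disjoint_ksubsets k F : Prop :=
  (forall i, #|F i| = k) /\ (forall i j, i != j -> [disjoint F i & F j]).

Definition disjoint_partial_difference_family k F : Prop :=
  disjoint_ksubsets k F /\
  exists lambda mu,
    \big[msetD/mset0]_i Delta (F i) = two_valued lambda mu (\bigcup_i F i).

Definition external_partial_difference_family k F : Prop :=
  disjoint_ksubsets k F /\
  exists lambda mu,
    \big[msetD/mset0]_i \big[msetD/mset0]_(j | i != j) Delta2 (F i) (F j)
      = two_valued lambda mu (\bigcup_i F i).

End Families.

End PartialDifferenceSets.

(* Main.v *)
Require Import Defs.
From mathcomp Require Import all_boot fingroup.
From mathcomp Require Import finmap multiset zify.

Local Open Scope group_scope.

(** For [g != 1], let [N_A g] be the number of ways to write [g] as [x y^-1]
    with [x, y] in [A]. Summing over the blocks, the internal differences take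
    the value [lambda + (r - 1) mu] on [S] and [r mu] off [S], and the external
    ones are [N_S] minus the internal ones, so it suffices that [N_S g] depends
    only on whether [g] is in [S]. By inclusion-exclusion
    [N_S g = n - 2 |T| + N_T g] with [T] the complement of [S], which settles
    (i) and (ii). In (iii), if [1] is not in [S] then [T = 1 |: U] with [U] a
    proper partial difference set; as [N_U g = N_U g^-1], properness forces
    [U = U^-1], whence [N_T g = N_U g + 2 [g \in U]]. *)

Section Multiplicities.

Set Implicit Arguments.
Unset Strict Implicit.
Local Open Scope mset_scope.
Local Open Scope group_scope.

Variable gT : finGroupType.
Implicit Types (A B U : {set gT}) (g : gT) (a b : nat).

Lemma mset_bigE (K : choiceType) (I : Type) (s : seq I) (P : pred I)
    (F : I -> {mset K}) (z : K) :
  (\big[msetD/mset0]_(i <- s | P i) F i) z = \sum_(i <- s | P i) F i z.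
Proof.
by apply: (big_morph (fun X : {mset K} => X z)) => [X Y|];
  rewrite ?msetE2 ?mset0E.
Qed.

Lemma copiesE a A g : copies a A g = if g \in A then a else 0.
Proof.
rewrite /copies mset_bigE; under eq_bigr do rewrite msetnE.
rewrite -big_mkcondr /=; case: ifP => gA.
  by rewrite (big_pred1 g) // => x; rewrite /= eq_sym andb_idl // => /eqP->.
by rewrite big1 // => x /andP[xA /eqP gx]; rewrite gx xA in gA.
Qed.

Lemma two_valuedE a b A g :
  two_valued a b A g = if g == 1 then 0 else if g \in A then a else b.
Proof.
rewrite /two_valued msetE2 !copiesE !inE andbT.
by case: (g == 1); case: (g \in A); rewrite ?addn0.
Qed.

(** Once [x] is chosen, [x * y^-1 = g] forces [y = g^-1 * x], so the multiplicity is a single sum of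
    products of indicators; the later counts are compared term by term in this form. *)
Lemma Delta2E A B g :
  Delta2 A B g = \sum_x ((x \in A) * (g^-1 * x \in B)%g)%N.
Proof.
rewrite /Delta2 mset_bigE big_mkcond; apply: eq_bigr => x _.
case: (x \in A); rewrite ?mul0n // mul1n mset_bigE.
under eq_bigr do rewrite msetnE.
have eqg y : (g == x * y^-1) = (y == g^-1 * x).
  by apply/eqP/eqP=> ->; rewrite invMg invgK ?mulgKV ?mulKVg.
rewrite -big_mkcondr /=; case: (boolP (g^-1 * x \in B)) => yB.
  by rewrite (big_pred1 (g^-1 * x)) // => y; rewrite /= eqg andb_idl // => /eqP->.
by rewrite big1 // => y /andP[]; rewrite eqg => yB' /eqP ye; rewrite -ye yB' in yB.
Qed.

Lemma DeltaE A g : Delta A g = if g == 1 then 0 else Delta2 A A g.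
Proof.
rewrite /Delta /Delta2 !mset_bigE; case: eqP => [->|/eqP g1].
  rewrite big1 // => x _; rewrite mset_bigE big1 // => y /andP[_ xy].
  by rewrite msetnE eq_sym -eq_mulgV1 (negPf xy).
apply: eq_bigr => x _; rewrite !mset_bigE big_mkcondr; apply: eq_bigr => y _.
case: eqP => //= ->; by rewrite msetnE mulgV (negPf g1).
Qed.

Lemma Delta2_disjoint1 A B : [disjoint A & B] -> Delta2 A B 1 = 0.
Proof.
move=> dAB; rewrite Delta2E big1 // => x _; rewrite invg1 mul1g.
by case: (boolP (x \in A)) => // xA; rewrite (disjointFr dAB xA).
Qed.

(** Swapping [x] and [y] inverts [x * y^-1]. *)
Lemma Delta2V A g : Delta2 A A g^-1 = Delta2 A A g.
Proof.
rewrite !Delta2E (reindex_inj (mulgI g^-1)); apply: eq_bigr => x _.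
by rewrite invgK mulKVg mulnC.
Qed.

Lemma sum_mem_translate A g : \sum_x ((g^-1 * x)%g \in A : nat) = #|A|.
Proof.
rewrite (reindex_inj (mulgI g)) -sum1_card [RHS]big_mkcond.
by apply: eq_bigr => x _; rewrite mulKg; case: (x \in A).
Qed.

Lemma Delta2_setC A g :
  (Delta2 A A g + 2 * #|~: A| = #|gT| + Delta2 (~: A) (~: A) g)%N.
Proof.
(* The two copies of the size of the complement become the indicators of [x] and of [g^-1 * x] lying
   outside [A]; the identity then holds for each [x]. *)
rewrite mul2n -addnn -{1}(sum_mem_translate _ 1) -(sum_mem_translate _ g).
rewrite !Delta2E -sum1_card -!big_split /=; apply: eq_bigr => x _.
by rewrite invg1 mul1g !inE; do 2!case: (_ \in A).
Qed.

Lemma Delta2_setU1 U g : g != 1 -> 1 \notin U ->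
  Delta2 (1 |: U) (1 |: U) g =
    (Delta2 U U g + (g \in U) + (g^-1 \in U)%g)%N.
Proof.
move=> g1 U1; rewrite !Delta2E.
(* The new pairs are [(1, g^-1)] and [(g, 1)]; the pair [(1, 1)] is excluded by [g != 1]. *)
have -> : (g^-1 \in U : nat) = \sum_x ((x == 1%g) * (g^-1 * x \in U)%g)%N.
  by rewrite (bigD1 1) //= eqxx mulg1 mul1n big1 ?addn0 // => x /negPf->.
have -> : (g \in U : nat) = \sum_x ((x \in U) * (g^-1 * x == 1)%g)%N.
  rewrite (bigD1 g) //= mulVg eqxx muln1 big1 ?addn0 // => x xg.
  by rewrite -eq_invg_mul invgK eq_sym (negPf xg) muln0.
rewrite -!big_split /=; apply: eq_bigr => x _; rewrite !inE.
case: (eqVneq x 1) => [->|_] /=.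
  by rewrite mulg1 (negPf U1) eq_invg1 (negPf g1) !mul0n.
case: (eqVneq (g^-1 * x) 1) => [->|_] /=; rewrite ?(negPf U1);
  by case: (x \in U); rewrite ?muln0 ?addn0.
Qed.

Lemma Delta_two_valuedP a b A :
  Delta A = two_valued a b A <->
  forall g, g != 1 -> Delta2 A A g = if g \in A then a else b.
Proof.
split=> [/msetP E g g1|E].
  by move: (E g); rewrite DeltaE two_valuedE (negPf g1).
by apply/msetP => g; rewrite DeltaE two_valuedE; case: ifPn => // /E.
Qed.

Lemma Delta_two_valued_setC a b A :
  Delta (~: A) = two_valued a b (~: A) ->
  exists a' b', Delta A = two_valued a' b' A.
Proof.
move=> /Delta_two_valuedP E.
(* [a] and [b] trade places, since lying in [A] means lying outside its complement. Truncation is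
   harmless: any value attained at some [g != 1] is a true difference by [Delta2_setC]. *)
exists (#|gT| + b - 2 * #|~: A|)%N, (#|gT| + a - 2 * #|~: A|)%N.
apply/Delta_two_valuedP => g g1; have := Delta2_setC A g.
rewrite E // inE; case: (g \in A) => /=; lia.
Qed.

Lemma Delta_two_valued_setU1 a b U : a <> b -> 1 \notin U ->
  Delta U = two_valued a b U ->
  Delta (1 |: U) = two_valued (a + 2) b (1 |: U).
Proof.
move=> ab U1 /Delta_two_valuedP E; apply/Delta_two_valuedP => g g1.
(* As [a <> b], the multiplicity of an element reveals whether it lies in [U]. *)
have UV : (g^-1 \in U) = (g \in U).
  move: (Delta2V U g); rewrite !E ?eq_invg1 //.
  by case: (g^-1 \in U); case: (g \in U) => // ?; case: ab.
rewrite Delta2_setU1 // UV E // !inE (negPf g1) /=; case: (g \in U); lia.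
Qed.

Lemma difference_set_two_valued A :
  difference_set A -> exists a b, Delta A = two_valued a b A.
Proof.
case=> a E; exists a, a; rewrite E; apply/msetP => g.
by rewrite copiesE two_valuedE !inE andbT; case: (g == 1); rewrite ?if_same.
Qed.

End Multiplicities.

Section Families.

Set Implicit Arguments.
Unset Strict Implicit.

Variables (gT : finGroupType) (r : nat) (D : 'I_r -> {set gT}).
Hypothesis disjD : forall i j, i != j -> [disjoint D i & D j].

Let S := \bigcup_i D i.

Lemma mem_bigcup_sum x : (x \in S : nat) = \sum_i (x \in D i).
Proof.
case: (boolP (x \in S)) => [/bigcupP[i _ xi]|xS].
  rewrite (bigD1 i) //= xi big1 // => j ji.
  by rewrite (disjointFl (disjD ji)).
rewrite big1 // => i _; case: (boolP (x \in D i)) => // xi.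
by case/negP: xS; apply/bigcupP; exists i.
Qed.

Lemma Delta2_bigcup g : Delta2 S S g = \sum_i \sum_j Delta2 (D i) (D j) g.
Proof.
rewrite Delta2E; under eq_bigr do rewrite !mem_bigcup_sum big_distrlr /=.
rewrite exchange_big; apply: eq_bigr => i _ /=.
by rewrite exchange_big; apply: eq_bigr => j _ /=; rewrite Delta2E.
Qed.

(** An element of [S] lies in exactly one block, and the other [r.-1] blocks contribute [mu]
    each. *)
Lemma sum_two_valued lambda mu g :
  \sum_i (if g \in D i then lambda else mu) =
    (if g \in S then lambda + r.-1 * mu else r * mu)%N.
Proof.
case: ifPn => [/bigcupP[i _ gi]|gS].
  rewrite (bigD1 i) //= gi (eq_bigr (fun=> mu)) => [|j ji].
    by rewrite sum_nat_const cardC1 card_ord.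
  by rewrite (disjointFl (disjD ji)).
rewrite (eq_bigr (fun=> mu)) ?sum_nat_const ?card_ord // => i _.
by case: ifP => // gi; case/negP: gS; apply/bigcupP; exists i.
Qed.

Lemma sum_Delta_two_valued lambda mu :
  (forall i, Delta (D i) = two_valued lambda mu (D i)) ->
  \big[msetD/mset0]_i Delta (D i) =
    two_valued (lambda + r.-1 * mu) (r * mu) S.
Proof.
move=> E; apply/msetP => g; rewrite mset_bigE two_valuedE.
under eq_bigr do rewrite E two_valuedE.
by case: (g == 1); [rewrite big1 | rewrite sum_two_valued].
Qed.

(** External differences are all differences of [S] minus the internal ones. The internal count
    never exceeds the total, so the subtractions are exact at every value attained. *)
Lemma sum_Delta2_two_valued a b a' b' :
  Delta S = two_valued a b S ->
  \big[msetD/mset0]_i Delta (D i) = two_valued a' b' S ->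
  \big[msetD/mset0]_i \big[msetD/mset0]_(j | i != j) Delta2 (D i) (D j) =
    two_valued (a - a') (b - b') S.
Proof.
move=> /Delta_two_valuedP tot /msetP int; apply/msetP => g.
rewrite mset_bigE two_valuedE.
under eq_bigr do rewrite mset_bigE.
case: (eqVneq g 1) => [->|g1].
  (* Disjoint blocks never produce the difference 1. *)
  by rewrite big1 // => i _; rewrite big1 // => j /disjD /Delta2_disjoint1.
move: (int g) (tot g g1); rewrite two_valuedE (negPf g1) mset_bigE.
under eq_bigr do rewrite DeltaE (negPf g1).
rewrite Delta2_bigcup => int_g tot_g.
have : \sum_i \sum_j Delta2 (D i) (D j) g =
    (\sum_i Delta2 (D i) (D i) g +
     \sum_i \sum_(j | i != j) Delta2 (D i) (D j) g)%N.
  rewrite -big_split; apply: eq_bigr => i _; rewrite (bigD1 i) //=.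
  by congr (_ + _)%N; apply: eq_bigl => j; rewrite eq_sym.
rewrite tot_g int_g; case: (g \in S); lia.
Qed.

End Families.

Theorem theorem2p12 (gT : finGroupType) (n r k lambda mu : nat)
    (D : 'I_r -> {set gT}) (S : {set gT}) :
  #|gT| = n ->
  disjoint_ksubsets k D ->
  (forall i, partial_difference_set n k lambda mu (D i)) ->
  S = \bigcup_i D i ->
  [\/ difference_set (~: S),
      proper_partial_difference_set (~: S)
    | proper_partial_difference_set ([set: gT]^# :\: S)] ->
  disjoint_partial_difference_family k D /\
  external_partial_difference_family k D.
Proof.
move=> _ kD pdsD -> hS; set T := \bigcup_i D i in hS.
have disjD := kD.2.
have int := sum_Delta_two_valued disjD
  (fun i => let: And3 _ _ E := pdsD i in E).
have [a [b tot]] : exists a b, Delta T = two_valued a b T.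
  suff [a [b /Delta_two_valued_setC //]] :
    exists a b, Delta (~: T) = two_valued a b (~: T).
  case: hS => [/difference_set_two_valued //|[a [b [_ [_ _ E]]]]|].
    by exists a, b.
  case=> a [b [ab [_ _ E]]].
  (* If 1 lies in [T], the given set is already the whole complement; otherwise the complement has 1
     as its only extra element. *)
  have [T1|T1] := boolP (1 \in T).
    suff <- : [set: gT]^# :\: T = ~: T by exists a, b.
    by apply/setP=> x; rewrite !inE; case: eqP => [->|_]; rewrite ?T1 ?andbT.
  suff -> : ~: T = 1 |: ([set: gT]^# :\: T).
    exists (a + 2)%N, b; apply: Delta_two_valued_setU1 => //.
    by rewrite !inE eqxx andbF.
  by apply/setP=> x; rewrite !inE; case: eqP => [->|_]; rewrite ?T1 //= andbT.
split; split=> //; first by do 2!eexists; exact: int.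
by do 2!eexists; exact: (sum_Delta2_two_valued disjD tot int).
Qed.
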